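(* Let $\Gamma$ be a finite cactus. Then \[\Delta(\Gamma)\leq\mathrm{pmd}(\Gamma)\leq\Delta(\Gamma)+1.\] Moreover, $\mathrm{pmd}(\Gamma)=\Delta(\Gamma)$ if $\Gamma$ is triangle-free and is not a cycle.
   Context: All graphs are simple. $\Delta(\cdot)$ denotes maximum valency (degree). A cactus is a connected graph in which any two (distinct) cycles have at most one vertex in common. A matching $M$ (a set of pairwise disjoint edges) of a graph $\Gamma=(V,E)$ is positive if there is $w\colon V\to\mathbb{R}$ with $w(u)+w(v)>0$ for every $uv\in M$ and $w(u)+w(v)<0$ for every $uv\in E\setminus M$. A positive matching decomposition (pmd) of $\Gamma$ is a partition $E=E_1\cup\cdots\cup E_p$ into pairwise disjoint subsets such that $E_i$ is a positive matching of $(V,E\setminus\bigcup_{j<i}E_j)$ for $i=1,\ldots,p$. $\mathrm{pmd}(\Gamma)$ denotes the smallest $p$ for which $\Gamma$ has a pmd with $p$ parts ($0$ if $\Gamma$ has no edges). *)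

(* Defs.v *)
From mathcomp Require Import all_boot all_order all_algebra.
From mathcomp Require Import boolp reals.
Set Implicit Arguments.
Unset Strict Implicit.
Unset Printing Implicit Defensive.
Import Order.TTheory GRing.Theory Num.Theory.

Record sgraph := SGraph {
  vertex :> finType;
  adj : rel vertex;
  adj_sym : symmetric adj;
  adj_irr : irreflexive adj }.

Definition edges (G : sgraph) : {set {set G}} :=
  [set [set p.1; p.2] | p : G * G & adj p.1 p.2].

Definition valency (G : sgraph) (x : G) : nat := #|[set y | adj x y]|.

Definition max_valency (G : sgraph) : nat := \max_(x : G) valency x.

Definition connected_graph (G : sgraph) : Prop :=
  forall x y : G, connect (@adj G) x y.

(* A cycle is given by the sequence of its vertices in cyclic order. Several
   sequences (rotations, reversals) describe the same cycle, so cycles are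
   compared through their edge sets. *)
Definition is_cycle (G : sgraph) (c : seq G) : bool :=
  (2 < size c) && ucycleb (@adj G) c.

Definition cycle_edges (G : sgraph) (c : seq G) : {set {set G}} :=
  [set [set x; next c x] | x in c].

Definition cactus (G : sgraph) : Prop :=
  connected_graph G /\
  forall c1 c2 : seq G, is_cycle c1 -> is_cycle c2 ->
    cycle_edges c1 <> cycle_edges c2 ->
    #|[set x | (x \in c1) && (x \in c2)]| <= 1.

Definition triangle_free (G : sgraph) : Prop :=
  ~ exists x y z : G, [/\ adj x y, adj y z & adj x z].

Definition is_cycle_graph (G : sgraph) : Prop :=
  exists c : seq G,
    [/\ is_cycle c, forall x : G, x \in c & edges G = cycle_edges c].

Section Pmd.
Variable R : realType.
Local Open Scope ring_scope.

(* [E] is the edge set of a graph on [T], so that the same vertex set can be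
   kept while edges are removed. *)
Definition positive_matching (T : finType) (E M : {set {set T}}) : Prop :=
  [/\ M \subset E, trivIset M &
   exists w : T -> R,
     (forall u v, [set u; v] \in M -> 0 < w u + w v) /\
     (forall u v, [set u; v] \in E :\: M -> w u + w v < 0)].

Definition is_pmd (T : finType) (E : {set {set T}}) (p : nat)
    (D : 'I_p -> {set {set T}}) : Prop :=
  [/\ E = \bigcup_(i < p) D i,
      forall i j : 'I_p, i != j -> [disjoint D i & D j] &
      forall i : 'I_p,
        positive_matching (E :\: \bigcup_(j < p | (j < i)%N) D j) (D i)].

Definition has_pmd (G : sgraph) (p : nat) : Prop :=
  exists D : 'I_p -> {set {set G}}, is_pmd (edges G) D.

Lemma card_edge (G : sgraph) (e : {set G}) : e \in edges G -> #|e| = 2%N.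
Proof.
case/imsetP=> -[x y]; rewrite inE /= => xy ->; rewrite cards2.
by case: eqVneq xy => // ->; rewrite adj_irr.
Qed.

Lemma ex_pmd (G : sgraph) : exists p, `[< has_pmd G p >].
Proof.
exists #|edges G|; apply/asboolP.
exists (fun i => [set enum_val i]); split.
- apply/setP=> e; apply/idP/bigcupP => [eE|[i _]].
    by exists (enum_rank_in eE e); rewrite // inE enum_rankK_in.
  by rewrite inE => /eqP ->; apply: enum_valP.
- move=> i j ij; rewrite disjoints1 inE.
  by apply: contra ij => /eqP /enum_val_inj ->.
move=> i; have eE := enum_valP i; set e := enum_val i in eE *.
split.
- rewrite sub1set inE eE andbT; apply/bigcupP => -[j ji].
  by rewrite inE => /eqP /enum_val_inj ij; rewrite ij ltnn in ji.
- by apply/trivIsetP => A B; rewrite !inE => /eqP -> /eqP ->; rewrite eqxx.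
exists (fun x => if x \in e then 1 else - 2%:R); split => u v.
  rewrite inE => /eqP uve.
  by rewrite -uve !inE !eqxx orbT addr_gt0.
rewrite !inE => /andP[uve /andP[_ uvE]].
have neg2 : 1 + - 2%:R < 0 :> R by rewrite subr_lt0 ltr1n.
case: ifP => ue; case: ifP => ve //.
- case/eqP: uve; apply/eqP; rewrite eqEcard (card_edge eE) (card_edge uvE).
  by rewrite leqnn andbT; apply/subsetP => z; rewrite !inE => /orP[] /eqP ->.
- by rewrite addrC.
- by rewrite -opprD oppr_lt0 addr_gt0.
Qed.

Definition pmd (G : sgraph) : nat := ex_minn (ex_pmd G).

End Pmd.

(* Main.v *)
Require Import Defs.
From mathcomp Require Import all_boot reals.
From mathcomp Require Import all_order all_algebra boolp lra zify.

(** The lower bound is local: the edges at a vertex of maximum valency lie in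
    pairwise different matchings ([valency_le_pmd]).

    For the upper bounds, a decomposition into [k] matchings is a proper edge
    colouring with colours [1..k] together with, for each colour [i], weights
    that are positive on the edges coloured [i] and negative on the edges of
    larger colour.  Colours and weights are built simultaneously while the
    graph is grown from one vertex.  A cactus can be grown so that each step
    either hangs one new vertex on an old one or glues a whole cycle at an old
    vertex, the only edges created being the obvious ones ([cactus_ind]).

    A pendant edge is harmless: any free colour will do, and its new end can
    be given whatever weights the old end requires ([peeling_hang],
    [peeling_path]).  The only difficulty is to close a cycle.  It is closed
    by one edge whose colour [s] is strictly smaller than all other colours of
    the cycle.  For colours above [s] the cycle is then an open path, so only
    the weights of colour [s] have to be chosen around the whole cycle
    ([peeling_ear]).

    - If every cycle has length at least four and [k] is the maximum valency,
      take [s = 1] (unless colour 1 is already on an edge at the root of the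
      cycle, [peeling_ear_first]).  The two ends of the closing edge absorb
      the arbitrary weight of the root, one of them having a neighbour on the
      cycle whose weight may be taken very negative.  In a cactus that is not
      a cycle, the presence of a cycle forces valency at least three, which
      provides the colours 2 and 3 for the rest of the cycle
      ([cactus_peeling_tight]).

    - With one more colour triangles can be allowed too.  In a triangle whose
      closing edge is opposite to the root the weight of the root must be
      negative for colour [s], so every vertex is kept in one of two states
      ([ready]): its weight for colour 1 is negative, or it is already met by
      colour 1, not by colour 2, and its weight for colour 2 is negative.  The
      additional colour pays for reserving 1 or 2 at that vertex, and a glued
      cycle leaves all its vertices in one of the two states
      ([cactus_peeling]). *)

Set Implicit Arguments.
Unset Strict Implicit.
Unset Printing Implicit Defensive.
Import Order.TTheory GRing.Theory Num.Theory.

(** * Growing a cactus *)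

Definition consecutive (T : eqType) (c : seq T) (x y : T) : bool :=
  (y == next c x) || (x == next c y).

Lemma next_last (T : eqType) (x : T) (p : seq T) :
  uniq (x :: p) -> next (x :: p) (last x p) = x.
Proof.
move=> up; rewrite next_nth mem_last index_last //.
by rewrite nth_default.
Qed.

Lemma eq_set2_cases (T : finType) (a b x y : T) :
  [set a; b] = [set x; y] -> (a = x /\ b = y) \/ (a = y /\ b = x).
Proof.
move=> /setP H.
have := H a; have := H b; have := H x; have := H y; rewrite !inE !eqxx !orbT /=.
move=> /orP[]/eqP-> /orP[]/eqP-> /esym/orP[]/eqP ? /esym/orP[]/eqP ?; subst; auto.
Qed.

Section Cactus.
Variable G : sgraph.
Hypothesis hG : cactus G.

(** A path [q] between two vertices of a cycle [c], with interior off [c],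
    closes up with one of the two arcs of [c] into a cycle that shares both
    ends with [c]; in a cactus it must be [c] itself, so [q] is an edge of
    [c]. *)
Lemma no_theta (c : seq G) (u u' : G) (q : seq G) :
  is_cycle c -> u \in c -> u' \in c -> u != u' ->
  path (@adj G) u (rcons q u') -> uniq q -> (forall x, x \in q -> x \notin c) ->
  q = [::] /\ consecutive c u u'.
Proof.
case/andP=> c3 /andP[cyc uc] uinc u'inc uu' pq uq qc.
have [n s def_s] := rot_to uinc.
have us : uniq (u :: s) by rewrite -def_s rot_uniq.
have cs : cycle (@adj G) (u :: s) by rewrite -def_s rot_cycle.
have memc : c =i u :: s by move=> z; rewrite -def_s mem_rot.
have u's : u' \in s by move: u'inc; rewrite memc inE eq_sym (negbTE uu').
have E0 : consecutive c u u' = consecutive (u :: s) u u'.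
  by rewrite /consecutive -def_s !next_rot.
case/splitPr: u's us cs memc E0 {def_s} => s1 s2 us cs memc E0.
(* The arc of [c] from [u] to [u'], followed by the path backwards. *)
pose c' := u :: s1 ++ u' :: rev q.
have lastc' : last u (s1 ++ u' :: rev q) = head u' q.
  by rewrite last_cat /=; case: (q) => //= x r; rewrite rev_cons last_rcons.
have next_c' : uniq c' -> next c' (head u' q) = u.
  by rewrite -lastc'; exact: next_last.
have uc' : uniq c'.
  rewrite /c' -cat_cons cat_uniq /= rev_uniq uq mem_rev andbT.
  have qC z : z \in q -> (z \notin u :: s1) && (z != u').
    by move/qc; rewrite memc -cat_cons mem_cat (in_cons u') !negb_or => /and3P[-> -> _].
  have -> : u' \notin q by apply/negP => /qC; rewrite eqxx andbF.
  move: us; rewrite /= mem_cat negb_or cat_uniq => /and3P[/andP[-> _] -> /= /andP[]].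
  rewrite negb_or => /andP[u's1 _] _; rewrite !negb_or (eq_sym u') uu' u's1 /= andbT.
  by apply/hasPn => z; rewrite mem_rev => /qC/andP[].
have cc' : cycle (@adj G) c'.
  move: cs; rewrite /c' /= !rcons_cat !cat_path /= => /and3P[-> -> _] /=.
  move: pq; rewrite -rev_path belast_rcons last_rcons rev_cons.
  by congr (is_true _); apply: eq_path => a b; exact: adj_sym.
have qne : q = [::] -> consecutive c u u' \/ 2 < size c'.
  move=> q0; rewrite E0 /c' q0; case: s1 us {cs memc E0 lastc' uc' cc' next_c' c'} => [|a s1] us /=.
    by left; rewrite /consecutive /= eqxx eqxx.
  by right; rewrite size_cat /= addn1.
have [/andP[/eqP]//|nc] := boolP ((q == [::]) && consecutive c u u').
exfalso.
have sz' : 2 < size c'.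
  have [q0|q0] := eqVneq q [::].
    by case: (qne q0) => // cuu'; rewrite q0 eqxx cuu' in nc.
  by rewrite /c' /= size_cat /= size_rev addnS !ltnS addn_gt0 orbC lt0n size_eq0 q0.
have iC' : is_cycle c' by rewrite /is_cycle sz' /ucycleb cc' uc'.
have iC : is_cycle c by rewrite /is_cycle c3 /ucycleb cyc uc.
(* The edge of [c'] that comes back to [u] cannot be an edge of [c]: its other
   end lies off [c], or it is a chord. *)
have ne : cycle_edges c <> cycle_edges c'.
  move=> E.
  have : [set head u' q; u] \in cycle_edges c'.
    apply/imsetP; exists (head u' q); first by rewrite -lastc' mem_last.
    by rewrite next_c'.
  rewrite -E => /imsetP[x xc /eq_set2_cases xE].
  have hc : head u' q \in c by case: xE => -[-> _]; rewrite ?mem_next.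
  have q0 : q = [::].
    by case: (q) qc hc => //= a r /(_ a); rewrite mem_head => /(_ isT)/negbTE ->.
  case/negP: nc; rewrite q0 eqxx /= /consecutive.
  by rewrite q0 /= in xE; case: xE => -[-> ->]; rewrite eqxx ?orbT.
move: (hG.2 _ _ iC iC' ne); apply/negP; rewrite -ltnNge.
apply: leq_trans (_ : #|[set u; u']| <= _); first by rewrite cards2 uu'.
apply/subset_leq_card/subsetP => z; rewrite !inE => /orP[]/eqP->.
  by rewrite uinc eqxx.
by rewrite u'inc mem_cat mem_head !orbT.
Qed.

End Cactus.

Section CactusInduction.
Variable G : sgraph.
Hypothesis hG : cactus G.

Definition outside_adj (S : {set G}) : rel G :=
  fun x y => [&& adj x y, x \notin S & y \notin S].

(** The invariant of the growth: each connected component of the complement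
    of [S] hangs on a single vertex of [S]. *)
Definition attached_once (S : {set G}) : Prop :=
  forall u u' x x', u \in S -> u' \in S -> x \notin S -> x' \notin S ->
    adj u x -> adj u' x' -> connect (outside_adj S) x x' -> u = u'.

Lemma outside_adj_sym S : symmetric (outside_adj S).
Proof. by move=> x y; rewrite /outside_adj adj_sym (andbC (x \notin S)). Qed.

Lemma connect_outside_sym S : connect_sym (outside_adj S).
Proof. exact/sym_connect_sym/outside_adj_sym. Qed.

Lemma connect_outsideS (S S' : {set G}) x y : S \subset S' ->
  connect (outside_adj S') x y -> connect (outside_adj S) x y.
Proof.
move=> sSS'; apply: connect_sub => a b /and3P[ab aS bS]; apply: connect1.
by rewrite /outside_adj ab (contra (subsetP sSS' a)) ?(contra (subsetP sSS' b)).
Qed.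

Lemma connect_outside_adj (S : {set G}) x y : x \notin S -> y \notin S ->
  adj x y -> connect (outside_adj S) x y.
Proof. by move=> xS yS xy; apply: connect1; rewrite /outside_adj xy xS. Qed.

Lemma outside_path (S : {set G}) x p : x \notin S ->
  path (outside_adj S) x p -> path (@adj G) x p /\ {in x :: p, forall z, z \notin S}.
Proof.
elim: p x => [|y p IH] x xS /=; first by split=> // z; rewrite inE => /eqP->.
case/andP=> /and3P[xy _ yS] /(IH _ yS)[-> H]; rewrite xy; split=> // z.
by rewrite inE => /predU1P[->//|]; apply: H.
Qed.

Lemma boundary_edge (S : {set G}) (r : G) :
  r \in S -> S != setT -> exists v y, [/\ v \in S, y \notin S & adj v y].
Proof.
move=> rS nS; have [//|H] := pselect (exists v y, [/\ v \in S, y \notin S & adj v y]).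
case/eqP: nS; apply/setP=> z; rewrite inE.
have cl : closed (@adj G) (mem S).
  apply: intro_closed => [|x y xy xS]; first exact/sym_connect_sym/adj_sym.
  by apply/negPn/negP => yS; apply: H; exists x, y.
by have /= := closed_connect cl (hG.1 r z); rewrite rS => <-.
Qed.

(** Let [y] be a new neighbour of a vertex [v] of [S].  If [y] is the only
    neighbour of [v] in its component of the complement, then [y] is hung on
    [v].  Otherwise a path of that component joins [y] to another neighbour of
    [v], and the cycle through [v] that it forms is glued.  By [no_theta] this
    cycle has no chord, and no outside path joins two of its vertices, so the
    invariant is preserved. *)
Theorem cactus_ind (P : {set G} -> Prop) (r : G) :
  P [set r] ->
  (forall S v y, P S -> v \in S -> y \notin S -> adj v y ->
     (forall u, u \in S -> adj u y -> u = v) -> P (y |: S)) ->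
  (forall S v (p : seq G), P S -> v \in S -> (forall x, x \in p -> x \notin S) ->
     is_cycle (v :: p) ->
     (forall x y, x \in p -> y \in S :|: [set z in p] -> adj x y ->
        consecutive (v :: p) x y) ->
     P (S :|: [set z in p])) ->
  P setT.
Proof.
move=> P1 Ppend Pear.
suff H n (S : {set G}) : #|~: S| < n -> r \in S -> P S -> attached_once S -> P setT.
  apply: (H #|~: [set r]|.+1 [set r]) => //; first by rewrite inE.
  by move=> u u' x x'; rewrite !inE => /eqP-> /eqP->.
elim: n S => // n IH S; rewrite ltnS => Sn rS PS attS.
have [<-//|nS] := eqVneq S setT.
have [v [y [vS yS vy]]] := boundary_edge rS nS.
have grow (S' : {set G}) : S \subset S' -> y \in S' -> P S' -> attached_once S' -> P setT.
  move=> sSS' yS'; apply: IH; last exact: (subsetP sSS').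
  apply: leq_trans Sn; apply: proper_card; rewrite properC; apply/properP.
  by split=> //; exists y.
pose Q y' := [&& y' != y, adj v y' & connect (outside_adj S) y y'].
have yout u x : u \in S -> adj u x -> connect (outside_adj S) x y -> u = v.
  move=> uS ux cxy; apply: (attS _ _ _ _ uS vS _ yS ux vy cxy).
  by case/connectP: cxy yS => -[|a s] /=; [move=> _ -> | case/andP=> /and3P[]].
have [/existsP[y' /and3P[y'y vy' /connectP[p0 p0P y'E]]]|noQ] :=
  boolP [exists y', Q y']; last first.
  apply: (grow (y |: S)); rewrite ?subsetUr ?setU11 //.
    by apply: (Ppend _ v) => // u uS uy; apply: yout uy _.
  move=> u u' x x' uS' u'S'; rewrite !in_setU1 !negb_or => /andP[xy xS] /andP[x'y x'S].
  move=> ux u'x' /(connect_outsideS (subsetUr _ _)) cxx'.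
  (* A component seen both from [y] and from [S] would contain a second
     neighbour of [v]. *)
  have key a b b' : adj y b -> b \notin S -> a \in S -> adj a b' -> b' != y ->
      connect (outside_adj S) b b' -> False.
    move=> yb bS aS ab' b'y cbb'.
    have cyb' := connect_trans (connect_outside_adj yS bS yb) cbb'.
    have av : a = v by apply: (yout a b') => //; rewrite connect_outside_sym.
    by case/existsP: noQ; exists b'; rewrite /Q b'y -av ab'.
  move: uS' u'S'; rewrite !in_setU1 => /predU1P[uy|uS] /predU1P[u'y|u'S].
  - by rewrite uy.
  - by rewrite uy in ux; case: (key _ _ _ ux xS u'S u'x' x'y cxx').
  - rewrite u'y in u'x'; rewrite connect_outside_sym in cxx'.
    by case: (key _ _ _ u'x' x'S uS ux xy cxx').
  - exact: (attS u u' x x').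
case/shortenP: p0P y'E => p pP up _ y'E {p0}.
have [pA pS] := outside_path yS pP.
have vp : v \notin y :: p by apply/negP => /pS; rewrite vS.
have pn : p != [::] by apply/eqP => p0; rewrite y'E p0 eqxx in y'y.
have cyC : is_cycle (v :: y :: p).
  rewrite /is_cycle /= ltnS ltnS lt0n size_eq0 pn /ucycleb /= vy rcons_path pA -y'E.
  by rewrite adj_sym vy' /=; move: vp up; rewrite /= => -> ->.
have cyp z : z \in y :: p -> connect (outside_adj S) z y.
  move=> zp; rewrite connect_outside_sym.
  by apply: (path_connect pP).
have atv u x : u \in S -> adj u x -> x \in y :: p -> u = v.
  by move=> uS ux /cyp; apply: yout.
set S' := S :|: [set z in y :: p].
have CS' z : z \in v :: y :: p -> z \in S'.
  by rewrite in_cons !inE => /orP[/eqP->|->]; rewrite ?vS ?orbT.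
apply: (grow S'); rewrite /S' ?subsetUl ?inE ?eqxx ?orbT //.
  apply: (Pear _ v) => // x z xp zS' xz.
  have zC : z \in v :: y :: p.
    move: zS'; rewrite in_cons in_setU in_set => /orP[zS|->]; last by rewrite orbT.
    by rewrite (atv z x) ?eqxx // adj_sym.
  have xC : x \in v :: y :: p by rewrite in_cons xp orbT.
  have xnz : x != z by apply: contraTneq xz => ->; rewrite adj_irr.
  by have [] := @no_theta _ hG _ x z [::] cyC xC zC xnz; rewrite /= ?xz.
move=> u u' x x' uS' u'S' xS' x'S' ux u'x' cxx'.
have xS : x \notin S by move: xS'; rewrite in_setU; case/norP.
have x'S : x' \notin S by move: x'S'; rewrite in_setU; case/norP.
have cS := connect_outsideS (subsetUl _ _) cxx'.
(* A component attached to a new vertex and to [S] is attached to [S] at [v]. *)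
have key a b b' : a \in y :: p -> adj a b -> b \notin S -> connect (outside_adj S) b b' ->
   forall a', a' \in S' -> adj a' b' -> a' \in v :: y :: p.
  move=> ap ab bS cbb' a'; rewrite in_cons in_setU in_set => /orP[a'S a'b'|->]; last by rewrite orbT.
  rewrite (yout a' b') ?eqxx // connect_outside_sym; apply: connect_trans cbb'.
  apply: connect_trans (connect_outside_adj (pS _ ap) bS ab).
  by rewrite connect_outside_sym cyp.
have [//|uu'] := eqVneq u u'; exfalso.
have [uC u'C] : u \in v :: y :: p /\ u' \in v :: y :: p.
  move: (uS') (u'S'); rewrite in_setU in_set => /orP[uS|up']; last first.
    by move=> u'S''; rewrite in_cons up' orbT (key u x x').
  rewrite in_setU in_set => /orP[u'S|u'p].
    by case/eqP: uu'; apply: attS cS.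
  by rewrite (in_cons v _ u') u'p orbT (key u' x' x) // connect_outside_sym.
case/connectP: cxx' => q0 q0P x'E; case/shortenP: q0P x'E => q qP uq _ x'E.
have [qA qS'] := outside_path xS' qP.
have [] := @no_theta _ hG _ u u' (x :: q) cyC uC u'C uu' _ uq => //.
  by rewrite /= ux rcons_path qA -x'E adj_sym.
by move=> z /qS'; apply: contra; apply: CS'.
Qed.

End CactusInduction.

(** * Colourings with weights *)

Section Peeling.
Local Open Scope ring_scope.
Variables (R : realType) (G : sgraph) (k : nat).
Implicit Types (c : G -> G -> nat) (w : nat -> G -> R).

(** A partial edge colouring (0 for uncoloured) with witnessing weights.  The
    edges still present when the matching of colour [i] is removed are those
    of colour at least [i]. *)
Record peeling c w : Prop := Peeling {
  peel_sym : forall x y, c x y = c y x;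
  peel_adj : forall x y, (0 < c x y)%N -> adj x y;
  peel_le : forall x y, (c x y <= k)%N;
  peel_proper : forall x y z, (0 < c x y)%N -> c x y = c x z -> y = z;
  peel_pos : forall i x y, (0 < i)%N -> c x y = i -> 0 < w i x + w i y;
  peel_neg : forall i x y, (0 < i < c x y)%N -> w i x + w i y < 0 }.

(** Once all edges are coloured, the colour classes form the decomposition:
    colour [i.+1] is the part of index [i]. *)
Lemma peeling_pmd c w : peeling c w -> (forall x y, adj x y -> (0 < c x y)%N) ->
  (pmd R G <= k)%N.
Proof.
move=> [cs ca ck cp wp wn] cc.
rewrite /pmd; case: ex_minnP => m _; apply; apply/asboolP.
pose D (i : 'I_k) : {set {set G}} := [set [set q.1; q.2] | q : G * G & c q.1 q.2 == i.+1].
have DP i x y : ([set x; y] \in D i) = (c x y == i.+1).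
  apply/imsetP/eqP => [[[a b]]|E]; last by exists (x, y); rewrite // inE E.
  by rewrite inE /= => /eqP <- /eq_set2_cases[[-> ->]|[-> ->]].
have Dset i e : e \in D i -> exists x y, e = [set x; y].
  by case/imsetP=> -[x y] _ ->; exists x, y.
have EP x y : ([set x; y] \in edges G) = adj x y.
  apply/imsetP/idP => [[[a b]]|E]; last by exists (x, y); rewrite // inE E.
  by rewrite inE /= => ab /eq_set2_cases[[-> ->]|[-> ->]]; rewrite // adj_sym.
have Eset e : e \in edges G -> exists x y, e = [set x; y].
  by case/imsetP=> -[x y] _ ->; exists x, y.
have UP (i : 'I_k) x y : ([set x; y] \in edges G :\: \bigcup_(j < k | (j < i)%N) D j)
    = (i < c x y)%N.
  rewrite inE EP; apply/andP/idP => [[nD /cc c0]|ic].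
    rewrite ltnNge; apply: contra nD => ci; apply/bigcupP.
    have ck' : ((c x y).-1 < k)%N by have := ck x y; lia.
    by exists (Ordinal ck'); rewrite ?DP /=; lia.
  split; last by apply: ca; lia.
  by apply/bigcupP => -[j ji]; rewrite DP => /eqP; lia.
exists D; split.
- apply/setP => e; apply/idP/bigcupP => [eE|[i _ eD]].
    have [x [y E]] := Eset _ eE; rewrite {}E EP in eE *.
    have ck' : ((c x y).-1 < k)%N by have := ck x y; have := cc _ _ eE; lia.
    by exists (Ordinal ck'); rewrite // DP /= prednK // cc.
  have [x [y E]] := Dset _ _ eD; rewrite {}E EP DP in eD *.
  by apply: ca; rewrite (eqP eD).
- move=> i j ij; apply/pred0P => e /=; apply/negP => /andP[eDi].
  have [x [y E]] := Dset _ _ eDi; rewrite {}E !DP in eDi *; rewrite (eqP eDi).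
  by rewrite eqSS; apply/negP.
move=> i; split.
- apply/subsetP => e eD; have [x [y E]] := Dset _ _ eD; rewrite {}E DP in eD *.
  by rewrite UP (eqP eD).
- apply/trivIsetP => A B AD BD; apply: contraR => /pred0Pn[z /andP[/= zA zB]].
  have norm e : e \in D i -> z \in e -> exists2 y, e = [set z; y] & c z y = i.+1.
    move=> eD; have [x [y E]] := Dset _ _ eD; rewrite {}E DP in eD *.
    rewrite !inE => /orP[]/eqP->; first by exists y; rewrite ?(eqP eD).
    by exists x; rewrite 1?setUC // cs (eqP eD).
  have [y -> cy] := norm _ AD zA; have [y' -> cy'] := norm _ BD zB.
  by rewrite (cp z y y') ?cy ?cy'.
exists (w i.+1); split=> x y; first by rewrite DP => /eqP; apply: wp.
rewrite inE UP DP => /andP[ne ic]; apply: wn; lia.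
Qed.

Definition recolor c (x y : G) (p : nat) : G -> G -> nat :=
  fun a b => if ((a == x) && (b == y)) || ((a == y) && (b == x)) then p else c a b.

Lemma recolorE c x y p : recolor c x y p x y = p.
Proof. by rewrite /recolor !eqxx. Qed.

Lemma recolor_sym c x y p : (forall a b, c a b = c b a) ->
  forall a b, recolor c x y p a b = recolor c x y p b a.
Proof. by move=> cs a b; rewrite /recolor orbC (andbC (a == x)) (andbC (a == y)) cs. Qed.

Lemma recolorC c x y p a b : recolor c x y p a b = recolor c y x p a b.
Proof. by rewrite /recolor orbC. Qed.

Lemma recolor_id c x y p a b : a != x -> a != y -> recolor c x y p a b = c a b.
Proof. by move=> /negbTE ax /negbTE ay; rewrite /recolor ax ay. Qed.

Lemma recolor_at c x y p b : x != y -> recolor c x y p x b = if b == y then p else c x b.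
Proof. by move=> /negbTE xy; rewrite /recolor eqxx xy orbF. Qed.

Lemma recolor_at2 c x y p b : x != y -> recolor c x y p y b = if b == x then p else c y b.
Proof. by move=> xy; rewrite recolorC recolor_at // eq_sym. Qed.

(** Colouring one more edge may come with new weights, which must be checked
    on the old edges and on the new one. *)
Lemma peeling_recolor c w w' x y p : peeling c w -> adj x y -> (0 < p <= k)%N ->
  (forall z, c x z != p) -> (forall z, c y z != p) -> c x y = 0 ->
  (forall i a b, (0 < i)%N -> c a b = i -> 0 < w' i a + w' i b) ->
  (forall i a b, (0 < i < c a b)%N -> w' i a + w' i b < 0) ->
  0 < w' p x + w' p y -> (forall i, (0 < i < p)%N -> w' i x + w' i y < 0) ->
  peeling (recolor c x y p) w'.
Proof.
move=> [cs ca ck cp _ _] xy /andP[p0 pk] xp yp cxy wp wn wpp wpn.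
have xney : x != y by apply: contraTneq xy => ->; rewrite adj_irr.
split.
- exact: recolor_sym.
- move=> a b; rewrite /recolor; case: ifP => [|_]; last exact: ca.
  by case/orP=> /andP[/eqP-> /eqP->]; rewrite // adj_sym.
- by move=> a b; rewrite /recolor; case: ifP.
- move=> a b b'.
  have [->|ax] := eqVneq a x.
    rewrite !recolor_at //; case: eqP => [->|_]; case: eqP => [->|_] //.
    + by move=> _ /eqP; rewrite eq_sym (negbTE (xp _)).
    + by move=> _ /eqP; rewrite (negbTE (xp _)).
    + exact: cp.
  have [->|ay] := eqVneq a y.
    rewrite !recolor_at2 //; case: eqP => [->|_]; case: eqP => [->|_] //.
    + by move=> _ /eqP; rewrite eq_sym (negbTE (yp _)).
    + by move=> _ /eqP; rewrite (negbTE (yp _)).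
    + exact: cp.
  by rewrite !recolor_id //; exact: cp.
- move=> i a b i0; rewrite /recolor; case: ifP => [|_]; last exact: wp.
  by case/orP=> /andP[/eqP-> /eqP->] <-; rewrite // addrC.
- move=> i a b; rewrite /recolor; case: ifP => [|_]; last exact: wn.
  by case/orP=> /andP[/eqP-> /eqP->] /wpn; rewrite // addrC.
Qed.

(** The weights of a new pendant vertex [y] overcome those of its neighbour
    [v], in the direction that the colour [p] of the edge requires. *)
Definition hang w (v y : G) (p : nat) : nat -> G -> R :=
  fun i z => if z == y then (if i == p then 1 + `|w i v| else - (1 + `|w i v|)) else w i z.

Lemma peeling_hang c w v y p : peeling c w -> adj v y -> (0 < p <= k)%N ->
  (forall z, c v z != p) -> (forall z, c y z = 0) ->
  peeling (recolor c v y p) (hang w v y p).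
Proof.
move=> cw vy pk vp y0; have [cs ca ck cp wp wn] := cw.
have vney : v == y = false by apply: contraTF vy => /eqP->; rewrite adj_irr.
have off i a b : (0 < i)%N -> (i <= c a b)%N -> (a == y = false) * (b == y = false).
  move=> i0 iab; split; apply/negP => /eqP E; move: iab; rewrite E ?y0; first lia.
  by rewrite cs y0; lia.
apply: (peeling_recolor cw) => //.
- by move=> z; rewrite y0; lia.
- by rewrite cs y0.
- move=> i a b i0 cab; have iab : (i <= c a b)%N by rewrite cab.
  by rewrite /hang !(off i a b i0 iab); apply: wp.
- move=> i a b /andP[i0 iab]; rewrite /hang !(off i a b i0 (ltnW iab)).
  by apply: wn; rewrite i0.
- rewrite /hang vney !eqxx; have := ler_norm (- w p v); rewrite normrN; lra.
move=> i /andP[_ ip]; rewrite /hang vney eqxx ltn_eqF //.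
by have := ler_norm (w i v); lra.
Qed.

Definition colored_degree c x : nat := #|[set y | (0 < c x y)%N]|.

Lemma free_color c w x (forb : seq nat) : peeling c w ->
  (colored_degree c x + size forb < k)%N ->
  exists p, [/\ (0 < p <= k)%N, p \notin forb & forall z, c x z != p].
Proof.
move=> cw; set used := [seq c x y | y <- enum [set y | (0 < c x y)%N]].
have -> : colored_degree c x = size used by rewrite size_map -cardE.
move=> lt_k; have [p pk pused] : exists2 p, p \in iota 1 k & p \notin forb ++ used.
  apply/hasP; rewrite has_predC; apply: contraTN lt_k => /allP sub.
  have := uniq_leq_size (iota_uniq 1 k) sub.
  by rewrite size_iota size_cat addnC -leqNgt.
move: pk pused; rewrite mem_iota mem_cat negb_or add1n ltnS => pk /andP[pforb pused].
exists p; split=> // z; apply: contraNneq pused => E; rewrite -E; apply: map_f.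
by rewrite mem_enum inE E; case/andP: pk.
Qed.

Lemma colored_degree_le c w x (A : {set G}) : peeling c w ->
  (forall y, y \in A -> adj x y /\ c x y = 0) ->
  (colored_degree c x + #|A| <= max_valency G)%N.
Proof.
move=> cw HA; apply: leq_trans (_ : (valency x <= _)%N); last exact: leq_bigmax.
rewrite /colored_degree -cardsUI (_ : _ :&: A = set0) ?cards0 ?addn0.
  apply/subset_leq_card/subsetP => y; rewrite !inE => /orP[|/HA[]//].
  exact: (peel_adj cw).
by apply/setP => y; rewrite !inE; apply/negP => /andP[cy /HA[_ E]]; rewrite E in cy.
Qed.

(** The outcome of hanging the path [l] on [v], with first colour [q] and all
    colours above [s].  No path edge being of colour at most [s], all weights
    of [l] for these colours are negative. *)
Record grown (s : nat) c w (v : G) (l : seq G) (q : nat) c' w' : Prop := Grown {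
  gr_peel : peeling c' w';
  gr_old : forall x y, x \notin l -> y \notin l -> c' x y = c x y;
  gr_wold : forall i x, x \notin l -> w' i x = w i x;
  gr_new : forall x y, x \in l -> (0 < c' x y)%N -> (s < c' x y)%N /\ y \in v :: l;
  gr_head : forall y, y \in l -> (0 < c' v y)%N -> y = head v l /\ c' v y = q;
  gr_path : path (fun x y => 0 < c' x y)%N v l;
  gr_neg : forall i x, x \in l -> (i <= s)%N -> w' i x < 0 }.

(** After its first edge, the path alternates the colours [s.+1] and [s.+2]. *)
Lemma peeling_path s c w v l q : peeling c w -> (s.+2 <= k)%N ->
  path (@adj G) v l -> uniq (v :: l) -> (forall x z, x \in l -> c x z = 0) ->
  (s < q <= k)%N -> (forall z, c v z != q) ->
  exists c' w', grown s c w v l q c' w'.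
Proof.
move=> + sk; elim: l c w v q => [|y l IH] c w v q cw.
  by move=> _ _ _ _ _; exists c, w; split.
move=> /= /andP[vy yl] /and3P[vnl ynl ul] l0 /andP[sq qk] vq.
have y0 z : c y z = 0 by apply: l0; rewrite mem_head.
have cw1 : peeling (recolor c v y q) (hang w v y q).
  by apply: peeling_hang => //; rewrite qk (leq_ltn_trans _ sq).
have vney : v != y by apply: contraNneq vnl => ->; rewrite mem_head.
have vl : v \notin l by apply: contra vnl; rewrite inE orbC => ->.
have [q' [/andP[sq' q'k] q'q]] : exists q', (s < q' <= k)%N /\ q' != q.
  have [->|qs] := eqVneq q s.+1; [exists s.+2 | exists s.+1]; split; lia.
have [|||z|c' [w' [cw' old wold new hd pth ng]]] := IH _ _ y q' cw1 yl _ _ _.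
- by rewrite /= ynl.
- move=> x z xl; rewrite recolor_id ?l0 ?inE ?xl ?orbT //.
    by apply: contraNneq vl => <-.
  by apply: contraNneq ynl => <-.
- by rewrite sq'.
- by rewrite recolor_at2 //; case: ifP => _; rewrite 1?eq_sym // y0; lia.
have cvy : c' v y = q by rewrite old // recolorE.
exists c', w'; split=> //.
- move=> x z; rewrite !inE !negb_or => /andP[xy xl] /andP[zy zl].
  rewrite old // /recolor (negbTE xy) (negbTE zy) ?andbF //.
- by move=> i x; rewrite inE negb_or => /andP[xy xl]; rewrite wold // /hang (negbTE xy).
- move=> x z; rewrite inE => /predU1P[->|xl]; last first.
    by move=> /new[] // ? zl; split=> //; rewrite inE zl orbT.
  have [zl|zl] := boolP (z \in l).
    by move=> /hd[] // _ ->; rewrite !inE zl !orbT.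
  rewrite old // recolor_at2 //; case: eqP => [->|_]; last by rewrite y0.
  by rewrite sq mem_head.
- move=> z; rewrite inE => /predU1P[->|zl]; first by rewrite cvy.
  rewrite (peel_sym cw') => /new[] // _.
  by rewrite (negbTE vnl).
- by rewrite /= cvy pth (leq_ltn_trans _ sq).
move=> i x; rewrite inE => /predU1P[-> is_|]; last exact: ng.
rewrite wold // /hang eqxx ltn_eqF ?(leq_ltn_trans is_) // oppr_lt0.
by rewrite ltr_wpDr ?normr_ge0.
Qed.

(** * Gluing a cycle *)

(** The outcome of gluing at [v] the cycle [v :: p]. *)
Record ear_colored c w (v : G) (p : seq G) c' w' : Prop := EarColored {
  ear_peel : peeling c' w';
  ear_old : forall x y, x \notin p -> y \notin p -> c' x y = c x y;
  ear_wold : forall i x, x \notin p -> w' i x = w i x;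
  ear_cycle : cycle (fun x y => 0 < c' x y)%N (v :: p);
  ear_new : forall x y, x \in p -> (0 < c' x y)%N -> y \in v :: p }.

(** The cycle [v :: rcons l b] is opened at the edge between [z], the last
    vertex of [l], and [b]: the vertex [b] and the path [l] are hung on [v]
    with colours above [s], and the missing edge receives colour [s].  The
    weights for colour [s] become [ub] at [b], [uz] at [z] and [ul] on the
    rest of [l]; the numerical hypotheses are the inequalities that the edges
    of the cycle impose.  The vertices [v] and [z] are adjacent only when [l]
    is a singleton, hence the last hypothesis. *)
Lemma peeling_ear s c w v l b p q ub uz ul :
  peeling c w -> (0 < s)%N -> (s.+2 <= k)%N ->
  cycle (@adj G) (v :: rcons l b) -> uniq (v :: rcons l b) -> l != [::] ->
  (forall x y, x \in rcons l b -> c x y = 0) ->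
  (s < p <= k)%N -> (s < q <= k)%N -> p != q ->
  (forall y, c v y != p) -> (forall y, c v y != q) ->
  0 < ub + uz -> w s v + ub < 0 -> w s v + ul < 0 -> ul + uz < 0 -> ul < 0 ->
  (1 < size l)%N || (w s v + uz < 0) ->
  exists c' w',
  [/\ ear_colored c w v (rcons l b) c' w',
      forall y, y \in rcons l b -> (0 < c' v y)%N -> (s < c' v y)%N,
      forall i x, x \in rcons l b -> (i < s)%N -> w' i x < 0,
      forall x, x \in l -> w' s x = uz \/ w' s x = ul &
      [/\ w' s b = ub, exists y, c' b y = s,
          forall y, [|| c' b y == 0, c' b y == s | c' b y == p] &
          forall i, i != s -> i != p -> w' i b < 0]].
Proof.
move=> cw s0 sk /=; rewrite !rcons_path !last_rcons => /andP[/andP[vl_ lb_] bv].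
rewrite rcons_uniq mem_rcons in_cons negb_or => /and3P[/andP[vb vl] bl ul_] l0.
move=> iso sp sq pq vp vq.
have pk : (0 < p <= k)%N by lia.
have sk' : (s <= k)%N by lia.
have [s_p s_0 p_0] : [/\ s != p, s != 0 & p != 0] by split; lia.
have lt_sp i : (i < s)%N -> i != p by lia.
have lt_sp' : (s < p)%N by lia.
move=> ubz uvb uvl ulz ul0 uvz.
set z := last v l.
have zl : z \in l by rewrite /z; case: (l) l0 => //= a t _; rewrite mem_last.
have zb : z != b by apply: contraNneq bl => <-.
have vz : v != z by apply: contraNneq vl => ->.
have b0 y : c b y = 0 by apply: iso; rewrite mem_rcons mem_head.
have cw1 : peeling (recolor c v b p) (hang w v b p).
  by apply: peeling_hang; rewrite // adj_sym.
have [||y|c2 [w2 [cw2 old wold new hd pth ng]]] := @peeling_path s _ _ v l q cw1 sk vl_ _ _ sq.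
- by rewrite /= vl.
- move=> x y xl; rewrite recolor_id ?iso ?mem_rcons ?inE ?xl ?orbT //.
    by apply: contraNneq vl => <-.
  by apply: contraNneq bl => <-.
- by rewrite recolor_at //; case: ifP.
(* So far, [b] has no other coloured edge than the one to [v]. *)
have c2b y : c2 b y = if y == v then p else 0.
  have [yl|yl] := boolP (y \in l); last by rewrite old // recolor_at2 // b0.
  rewrite (negbTE (_ : y != v)); last by apply: contraNneq vl => <-.
  apply/eqP; rewrite -leqn0 leqNgt (peel_sym cw2); apply/negP => /new[] // _.
  by rewrite inE eq_sym (negbTE vb) (negbTE bl).
have c2z : c2 z b = 0 by rewrite (peel_sym cw2) c2b eq_sym (negbTE vz).
pose u y := if y == b then ub else if y == z then uz else if y \in l then ul else w s y.
pose w3 i := if i == s then u else w2 i.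
have w2o i y : y \notin l -> y != b -> w2 i y = w i y.
  by move=> yl /negbTE yb; rewrite wold // /hang yb.
have uo y : y \notin l -> y != b -> u y = w s y.
  move=> yl /negbTE yb; rewrite /u yb (negbTE yl) ifN //.
  by apply: contraNneq yl => ->.
have uv : u v = w s v by apply: uo.
have ulP y : y \in l -> u y = uz /\ y = z \/ u y = ul.
  move=> yl; rewrite /u (negbTE (_ : y != b)); last by apply: contraNneq bl => <-.
  by case: eqP => [|_]; [left | rewrite yl; right].
have ub_b : u b = ub by rewrite /u eqxx.
have wib i : i != p -> w2 i b < 0.
  move=> ip; rewrite wold // /hang eqxx (negbTE ip) oppr_lt0.
  by rewrite ltr_wpDr ?normr_ge0.
have usum a d : (s < c2 a d)%N -> u a + u d < 0.
  have keyl a' d' : (s < c2 a' d')%N -> a' \in l -> u a' + u d' < 0.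
    move=> sad al; have := new a' d' al (leq_ltn_trans (leq0n _) sad).
    case=> _; rewrite inE => /predU1P[dv|dl].
      rewrite dv uv in sad *; case: (ulP _ al) => [[-> az]|->]; last by lra.
      case/orP: uvz => [l2|]; last by lra.
      move: sad; rewrite (peel_sym cw2) => sad.
      have [/esym E _] := hd _ al (leq_ltn_trans (leq0n _) sad).
      by move: az E ul_ l2; rewrite /z; case: (l) => [|a0 [|a1 t]] //= -> -> /andP[]; rewrite mem_last.
    case: (ulP _ al) (ulP _ dl) => [[-> az]|->] [[-> dz]|->]; try lra.
    have := peel_adj cw2 (leq_ltn_trans (leq0n _) sad).
    by rewrite az dz adj_irr.
  have keyb d' : (s < c2 b d')%N -> u b + u d' < 0.
    by rewrite c2b; case: eqP => [->|]; rewrite ?ltn0 // uv ub_b => _; lra.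
  move=> sad.
  have [al|al] := boolP (a \in l); first exact: keyl.
  have [dl|dl] := boolP (d \in l).
    by rewrite addrC; apply: keyl; rewrite // (peel_sym cw2).
  have [E|ab] := eqVneq a b; first by rewrite E in sad *; apply: keyb.
  have [E|db] := eqVneq d b.
    by rewrite E in sad *; rewrite addrC; apply: keyb; rewrite // (peel_sym cw2).
  rewrite !uo // -!w2o //; apply: (peel_neg cw2); rewrite s0 //.
have cw3 : peeling (recolor c2 z b s) w3.
  apply: (peeling_recolor cw2) => //.
  - by rewrite s0.
  - by move=> y; apply/eqP => E; have [] := new z y zl; rewrite E // ltnn.
  - by move=> y; rewrite c2b; case: ifP => _; rewrite eq_sym.
  - move=> i a d i0 E; rewrite /w3; case: eqP => [is_|_]; last exact: (peel_pos cw2).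
    have nl a' d' : c2 a' d' = i -> (a' \notin l) && (a' != b).
      move=> E'; apply/andP; split.
        by apply/negP => /(new a' d'); rewrite E' is_ ltnn => -[].
      by apply: contraTneq s_p => ab; move: E'; rewrite ab c2b is_; case: ifP => _ E'; rewrite -E' eqxx // in s_0 *.
    have /andP[al ab] := nl _ _ E.
    rewrite (peel_sym cw2) in E; have /andP[dl db] := nl _ _ E.
    by rewrite !uo // -!w2o // -is_ addrC; apply: (peel_pos cw2).
  - move=> i a d /andP[i0 id]; rewrite /w3; case: eqP => [is_|_].
      by apply: usum; rewrite -is_.
    by apply: (peel_neg cw2); rewrite i0.
  - rewrite /w3 eqxx ub_b; case: (ulP z zl) => [[-> _]|]; first by lra.
    by rewrite /u (negbTE zb) eqxx; lra.
  move=> i /andP[i0 is_]; rewrite /w3 ltn_eqF //.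
  by have := ng i z zl (ltnW is_); have := wib i (lt_sp i is_); lra.
exists (recolor c2 z b s), w3; split.
- split=> //.
  + move=> x y; rewrite !mem_rcons !inE !negb_or => /andP[xb xl] /andP[yb yl].
    rewrite recolor_id //; last by apply: contraNneq xl => ->.
    by rewrite old // /recolor (negbTE xb) (negbTE yb) !andbF.
  + move=> i x; rewrite mem_rcons inE negb_or => /andP[xb xl].
    by rewrite /w3; case: eqP => [->|_]; rewrite ?uo ?w2o.
  + rewrite /= !rcons_path !last_rcons -/z recolorE s0 andbT; apply/andP; split.
      apply: sub_path pth => x y cxy; rewrite /recolor; case: ifP => //.
    by rewrite recolor_at2 // (negbTE vz) c2b eqxx lt0n.
  + move=> x y; rewrite mem_rcons inE => /predU1P[->|xl].
      rewrite recolor_at2 // in_cons mem_rcons in_cons; case: eqP => [-> _|_].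
        by rewrite zl !orbT.
      by rewrite c2b; case: eqP => // ->.
    rewrite /recolor; case: ifP => [/orP[]/andP[_ /eqP->] _|_].
    * by rewrite in_cons mem_rcons mem_head orbT.
    * by rewrite in_cons mem_rcons in_cons zl !orbT.
    move/new => /(_ xl)[_]; rewrite !in_cons mem_rcons in_cons.
    by case/orP=> ->; rewrite ?orbT.
- move=> y; rewrite recolor_id //; rewrite mem_rcons in_cons => /predU1P[->|yl].
    by rewrite (peel_sym cw2) c2b eqxx.
  by rewrite (peel_sym cw2) => /new[].
- move=> i x; rewrite mem_rcons in_cons => xbl is_; rewrite /w3 ltn_eqF //.
  case/predU1P: xbl => [->|xl]; first by apply/wib/lt_sp.
  by apply: ng => //; apply: ltnW.
- by move=> x xl; rewrite /w3 eqxx; case: (ulP _ xl) => [[]|]; auto.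
split.
- by rewrite /w3 eqxx.
- by exists z; rewrite recolor_at2 // eqxx.
- by move=> y; rewrite recolor_at2 //; case: ifP => _; rewrite ?eqxx ?orbT // c2b; case: ifP; rewrite eqxx ?orbT.
by move=> i /negbTE is_ ip; rewrite /w3 is_; apply: wib.
Qed.

(** The variant where the edge of colour 1 is at the root: the whole cycle
    but its last edge is hung on [v] as a path.  For colour 1 the last vertex
    [b] compensates the weight of [v], and the other vertices are very
    negative. *)
Lemma peeling_ear_first c w v l b q :
  peeling c w -> (3 <= k)%N ->
  cycle (@adj G) (v :: rcons l b) -> uniq (v :: rcons l b) -> l != [::] ->
  (forall x y, x \in rcons l b -> c x y = 0) ->
  (1 < q <= k)%N -> (forall y, c v y != 1) -> (forall y, c v y != q) ->
  exists c' w', ear_colored c w v (rcons l b) c' w'.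
Proof.
move=> cw k3 /=; rewrite rcons_path last_rcons => /andP[vlb bv].
have k1 : (0 < 1 <= k)%N by lia.
set m := rcons l b => /andP[vm um] l0 iso qk v1 vq.
have q1 : (1 < q)%N by case/andP: qk.
have vb : v != b by apply: contraNneq vm => ->; rewrite /m mem_rcons mem_head.
have bm : b \in m by rewrite mem_rcons mem_head.
have [|c2 [w2 [cw2 old wold new hd pth ng]]] := peeling_path cw k3 vlb _ iso qk vq.
  by rewrite /= vm.
have c2b : c2 v b = 0.
  apply/eqP; rewrite -leqn0 leqNgt; apply/negP => /(hd _ bm)[E _].
  move: E um l0; rewrite /m; case: (l) => //= a t ->.
  by rewrite mem_rcons mem_head.
have c2v1 y : c2 v y != 1.
  have [ym|ym] := boolP (y \in m); last by rewrite old.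
  by apply/eqP => E; have [] := hd y ym; rewrite E // => _ q1'; rewrite -q1' in q1.
pose u y := if y == b then 1 + `|w 1 v| else if y \in m then - (2 + `|w 1 v|) else w 1 y.
pose w3 i := if i == 1 then u else w2 i.
have mb y : y \notin m -> y == b = false by move=> ym; apply: contraNF ym => /eqP->.
have uo y : y \notin m -> u y = w2 1 y by move=> ym; rewrite /u mb // (negbTE ym) wold.
have uv : u v = w 1 v by rewrite uo // wold.
have usum a d : (1 < c2 a d)%N -> u a + u d < 0.
  have n1 := ler_norm (w 1 v); have n2 := normr_ge0 (w 1 v).
  have keym a' d' : (1 < c2 a' d')%N -> a' \in m -> u a' + u d' < 0.
    move=> sad al; have c0 := leq_ltn_trans (leq0n _) sad.
    have [_ dvm] := new a' d' al c0.
    have ne : a' != d' by apply: contraTneq (peel_adj cw2 c0) => ->; rewrite adj_irr.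
    move: dvm; rewrite inE => /predU1P[dv|dm].
      rewrite dv uv in sad *; rewrite /u al; case: eqP => [ab|_]; last by lra.
      by move: sad; rewrite ab (peel_sym cw2) c2b.
    rewrite /u al dm; case: eqP => [ab|_]; case: eqP => [db|_]; try lra.
    by rewrite ab db eqxx in ne.
  move=> sad.
  have [am|am] := boolP (a \in m); first exact: keym.
  have [dm|dm] := boolP (d \in m).
    by rewrite addrC; apply: keym; rewrite // (peel_sym cw2).
  by rewrite !uo //; apply: (peel_neg cw2).
exists (recolor c2 v b 1), w3; split.
- apply: (peeling_recolor cw2); rewrite 1?adj_sym //.
  + by move=> y; apply/eqP => E; have [] := new b y bm; rewrite E.
  + move=> i a d i0 E; rewrite /w3; case: eqP => [i1|_]; last exact: (peel_pos cw2).
    have nm a' d' : c2 a' d' = i -> a' \notin m.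
      by move=> E'; apply/negP => /(new a' d'); rewrite E' i1 ltnn => -[].
    rewrite !uo ?(nm a d) ?(nm d a) //; last by rewrite (peel_sym cw2).
    by apply: (peel_pos cw2); rewrite ?E.
  + move=> i a d /andP[i0 id]; rewrite /w3; case: eqP => [i1|_].
      by rewrite i1 in id; apply: usum.
    by apply: (peel_neg cw2); rewrite i0.
  + rewrite /w3 /= uv /u eqxx; have := ler_norm (- w 1 v); rewrite normrN; lra.
  + by case=> [|[]].
- move=> x y xm ym; rewrite -old // /recolor (mb x) // (mb y) // !andbF //.
- move=> i x xm; rewrite /w3; case: eqP => [->|_]; rewrite ?uo //; exact: wold.
- rewrite /= rcons_path last_rcons -/m recolorC recolorE andbT.
  by apply: sub_path pth => x y cxy; rewrite /recolor; case: ifP.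
move=> x y xm; rewrite /recolor; case: ifP => [/orP[]/andP[_ /eqP->] _|_ /new[]//].
- by rewrite inE bm orbT.
- exact: mem_head.
Qed.

End Peeling.

(** * Valency and cycles *)

(** Edges at one vertex that lie in a common matching coincide. *)
Lemma valency_le_pmd (R : realType) (G : sgraph) : (max_valency G <= pmd R G)%N.
Proof.
rewrite /pmd; case: ex_minnP => p /asboolP[D [ED _ DM]] _.
apply/bigmax_leqP => x _; rewrite /valency.
pose f y := [pick i | [set x; y] \in D i].
have fP y : adj x y -> exists2 i, f y = Some i & [set x; y] \in D i.
  move=> xy; rewrite /f; case: pickP => [i|D0]; first by exists i.
  have : [set x; y] \in edges G by apply/imsetP; exists (x, y); rewrite ?inE.
  by rewrite ED => /bigcupP[i _]; rewrite D0.
have finj : {in [set y | adj x y] &, injective f}.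
  move=> y y'; rewrite !inE => /fP[i -> iy] /fP[i' -> iy'] [ii'].
  rewrite -{}ii' in iy'.
  have [_ /trivIsetP tr _] := DM i.
  have E : [set x; y] = [set x; y'].
    apply/eqP; apply: contraT => /(tr _ _ iy iy') /pred0P/(_ x).
    by rewrite /= !inE eqxx.
  by case: (eq_set2_cases E) => -[E1 E2]; rewrite E2.
rewrite -(card_in_imset finj).
have /leq_trans : #|f @: [set y | adj x y]| <= #|[set Some i | i : 'I_p]|.
  apply/subset_leq_card/subsetP => z /imsetP[y]; rewrite inE => /fP[i -> _] ->.
  exact: imset_f.
by apply; rewrite (leq_trans (leq_imset_card _ _)) ?card_ord.
Qed.

Section CyclesInGraph.
Variable G : sgraph.

Lemma cycle_size_gt3 (c : seq G) : triangle_free G -> is_cycle c -> (3 < size c)%N.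
Proof.
move=> tf; rewrite /is_cycle; case: c => [|x [|y [|z [|t c]]]] //=.
case/andP=> /and4P[xy yz zx _] _; case: tf; exists x, y, z.
by rewrite xy yz adj_sym zx.
Qed.

(** If all valencies are at most two, the vertices of a cycle have no
    neighbours off the cycle, which by connectedness is the whole graph. *)
Lemma noncycle_max_valency_gt2 (c : seq G) : connected_graph G ->
  ~ is_cycle_graph G -> is_cycle c -> (2 < max_valency G)%N.
Proof.
move=> conn nocyc cc; rewrite ltnNge; apply/negP => D2; apply: nocyc.
have /and3P[c3 cyc uc] := cc.
have nn x : x \in c -> next c (next c x) != x.
  move=> /rot_to[n s E].
  have nE y : next c y = next (x :: s) y by rewrite -E next_rot.
  rewrite !nE.
  move: c3 uc; rewrite -(size_rot n) -(rot_uniq n) E.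
  case: s {E nE} => [|a [|d t]] //= _ /and3P[].
  rewrite !inE !negb_or => /and3P[xa xd _] _ _.
  by rewrite !eqxx ?(eq_sym a x) ?(negbTE xa) ?eqxx eq_sym.
have nbr x : x \in c -> [set y | adj x y] = [set next c x; prev c x].
  move=> xc; apply/esym/eqP; rewrite eqEcard; apply/andP; split.
    apply/subsetP => y; rewrite !inE => /orP[]/eqP->; first exact: next_cycle.
    by rewrite adj_sym; apply: prev_cycle.
  rewrite cards2; have -> : next c x != prev c x.
    apply: contraNneq (nn x xc) => ->; rewrite next_prev //.
  by apply: leq_trans D2; apply: (leq_bigmax x).
have allc x : x \in c.
  have [r rc] : exists r, r \in c by case: (c) c3 => // a t _; exists a; apply: mem_head.
  have cl : closed (@adj G) (mem c).
    apply: intro_closed => [|a b ab ac]; first exact/sym_connect_sym/adj_sym.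
    have : b \in [set y | adj a y] by rewrite inE.
    by rewrite nbr // !inE => /orP[]/eqP->; rewrite ?mem_next ?mem_prev.
  by have /= := closed_connect cl (conn r x); rewrite rc => <-.
exists c; split=> //; apply/setP => e; apply/imsetP/imsetP => -[].
  move=> [x y]; rewrite inE /= => xy ->.
  have : y \in [set y | adj x y] by rewrite inE.
  rewrite nbr // !inE => /orP[]/eqP->; first by exists x.
  by exists (prev c x); rewrite ?mem_prev // next_prev // setUC.
move=> x xc ->; exists (x, next c x) => //; rewrite inE /=; exact: next_cycle.
Qed.

End CyclesInGraph.

(** * Colouring a cactus *)

Section CactusPeeling.
Local Open Scope ring_scope.
Variables (R : realType) (G : sgraph).
Hypothesis hG : cactus G.
Implicit Types (c : G -> G -> nat) (w : nat -> G -> R) (S : {set G}).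

(** The colouring of the part of the graph grown so far. *)
Definition spans c S : Prop :=
  (forall x y, x \in S -> y \in S -> adj x y -> (0 < c x y)%N) /\
  (forall x y, x \notin S -> c x y = 0).

Lemma peeling0 k : peeling k (fun _ _ : G => 0) (fun _ _ => - 1 : R).
Proof. by split=> // i x y; lia. Qed.

Lemma spans0 r : spans (fun _ _ => 0) [set r].
Proof. by split=> // x y; rewrite !inE => /eqP-> /eqP->; rewrite adj_irr. Qed.

Lemma spans_pendant c S v y p : spans c S -> v \in S -> y \notin S ->
  (forall u, u \in S -> adj u y -> u = v) -> (0 < p)%N ->
  spans (recolor c v y p) (y |: S).
Proof.
move=> [cS c0] vS yS yv p0; split=> [a b|a b].
  rewrite !in_setU1 => /predU1P[->|aS] /predU1P[->|bS].
  - by rewrite adj_irr.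
  - by rewrite adj_sym => /(yv _ bS)->; rewrite recolorC recolorE.
  - by move=> /(yv _ aS)->; rewrite recolorE.
  - by move=> ab; rewrite /recolor; case: ifP => // _; apply: cS.
rewrite in_setU1 negb_or => /andP[ay aS]; rewrite recolor_id ?c0 //.
by apply: contraNneq aS => ->.
Qed.

Lemma spans_ear k c w v p c' w' S : ear_colored k c w v p c' w' ->
  uniq (v :: p) -> spans c S -> v \in S -> (forall x, x \in p -> x \notin S) ->
  (forall x y, x \in p -> y \in S :|: [set z in p] -> adj x y ->
     consecutive (v :: p) x y) ->
  spans c' (S :|: [set z in p]).
Proof.
move=> [pc' old _ cyc new] up [cS c0] vS pS cons; have cs' := peel_sym pc'.
have vpS x : x \in v :: p -> x \in S :|: [set z in p].
  by rewrite !inE => /predU1P[->|->]; rewrite ?vS ?orbT.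
have keyp x y : x \in p -> y \in S :|: [set z in p] -> adj x y -> (0 < c' x y)%N.
  move=> xp yS xy; have /orP[] := cons _ _ xp yS xy => /eqP.
    by move->; apply: (next_cycle cyc); rewrite inE xp orbT.
  move=> E; rewrite cs' {1}E; apply: (next_cycle cyc).
  by rewrite -mem_next -E inE xp orbT.
have nS x : x \in S -> x \notin p by apply: contraTN => /pS.
split=> [x y xS yS xy|x y].
  have [xp|xp] := boolP (x \in p); first exact: keyp.
  have [yp|yp] := boolP (y \in p); first by rewrite cs'; apply: keyp; rewrite // adj_sym.
  rewrite old //; apply: cS => //.
    by move: xS; rewrite !inE (negbTE xp) orbF.
  by move: yS; rewrite !inE (negbTE yp) orbF.
move=> xS; move: (xS); rewrite !inE => /norP[xS' xp].
have [yp|yp] := boolP (y \in p); last by rewrite old // c0.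
apply/eqP; rewrite -leqn0 leqNgt; apply: contra xS.
by rewrite cs' => /(new _ _ yp)/vpS.
Qed.

(** A glued cycle adds two edges at its root, both counted by the valency but
    not yet coloured, which bounds the number of colours already used there. *)
Lemma ear_shape S v (p : seq G) c : spans c S -> is_cycle (v :: p) ->
  (forall x, x \in p -> x \notin S) -> v \in S ->
  exists l b, [/\ p = rcons l b, l != [::],
    uniq (v :: p), (forall x y, x \in p -> c x y = 0) &
    forall k w, peeling k c w -> (colored_degree c v + 2 <= max_valency G)%N].
Proof.
move=> [_ c0] /and3P[sz cyc up] pS vS.
have iso x y : x \in p -> c x y = 0 by move=> /pS/c0.
case/lastP: p sz cyc up pS iso => // l b sz cyc up pS iso.
case: l sz cyc up pS iso => // a l sz cyc up pS iso.
exists (a :: l), b; split=> // k w pc.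
have ab : a != b by move: up; rewrite /= mem_rcons inE negb_or => /and3P[_ /andP[]].
rewrite (_ : 2%N = #|[set a; b]|); last by rewrite cards2 ab.
apply: (colored_degree_le pc) => y yab.
have yp : y \in rcons (a :: l) b.
  by move: yab; rewrite !inE mem_rcons inE => /orP[]/eqP->; rewrite eqxx ?orbT.
split; last by rewrite (peel_sym pc) iso.
move: cyc yab; rewrite /= rcons_path last_rcons adj_sym => /and3P[va _ vb].
by rewrite !inE => /orP[]/eqP->; rewrite // adj_sym.
Qed.

(** The vertices at which a further cycle can be glued, triangles included:
    the closing edge gets colour 1 in the first state, colour 2 in the
    second. *)
Definition ready c w x : Prop :=
  w 1 x < 0 \/ [/\ exists y, c x y = 1, forall y, c x y != 2 & w 2 x < 0].

(** The colour [s] to be kept off the new edges at [v].  In the second state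
    colour 1 already occurs at [v], so that avoiding colour 2 is enough to
    use only larger colours. *)
Lemma ready_reserved k c w v : peeling k c w -> ready c w v ->
  exists s, [/\ (0 < s <= 2)%N, w s v < 0,
    (s <= colored_degree c v + 1)%N,
    forall p, (0 < p)%N -> p != s -> (forall y, c v y != p) -> (s < p)%N &
    s = 1 -> w 1 v < 0].
Proof.
move=> pc [w1|[[y cy] c2 w2]]; [exists 1 | exists 2]; split=> //.
- by rewrite addn1.
- by case=> [|[]].
- rewrite addn1 ltnS; apply/card_gt0P; exists y; by rewrite inE cy.
- by case=> [|[|[|p]]] // _ _ /(_ y); rewrite cy.
Qed.

(** All new edges at an old vertex [v] have colours above its reserved colour
    [s].  After a cycle is glued with closing colour [s = 1], all its new
    vertices have negative weight for colour 1 except one end of the closing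
    edge, which moves to the second state; with [s = 2], colour 1 is absent
    from the cycle and all new weights for colour 1 are negative. *)
Lemma cactus_peeling (r : G) :
  exists c w, peeling (max_valency G).+1 c w /\ spans c setT.
Proof.
set k := (max_valency G).+1.
pose P S := exists c w, [/\ peeling k c w, spans c S & forall x, ready c w x].
suff [c [w [pc sc _]]] : P setT by exists c, w.
apply: (cactus_ind hG (r := r)).
- exists (fun _ _ => 0), (fun _ _ => - 1).
  by split=> [||x]; [apply: peeling0|apply: spans0|left; rewrite ltrN10].
- move=> S v y [c [w [pc sc rd]]] vS yS vy yv.
  have y0 z : c y z = 0 by apply: sc.2.
  have deg : (colored_degree c v + 1 <= max_valency G)%N.
    rewrite -(cards1 y); apply: (colored_degree_le pc) => z; rewrite inE => /eqP->.
    by rewrite vy (peel_sym pc) y0.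
  have [s [s12 wsv _ lt_s ws1]] := ready_reserved pc (rd v).
  have [|p [pk]] := @free_color _ _ _ c w v [:: s] pc; first by rewrite /= ltnS.
  rewrite inE => ps vp.
  have sp : (s < p)%N by apply: lt_s => //; case/andP: pk.
  have p1 : p != 1 by apply: contraTneq sp => ->; case/andP: s12; case: (s) => [|[]].
  have vney : v != y by apply: contraNneq yS => <-.
  exists (recolor c v y p), (hang w v y p); split; first exact: peeling_hang.
    by apply: spans_pendant => //; case/andP: pk.
  move=> x; have [->|xy] := eqVneq x y.
    left; rewrite /hang eqxx eq_sym (negbTE p1) oppr_lt0.
    by rewrite ltr_wpDr ?normr_ge0.
  rewrite /ready /hang (negbTE xy); case: (rd x) => [|[[z xz] x2 w2]]; first by left.
  have zy : z != y by apply: contra_eq_neq xz => ->; rewrite (peel_sym pc) y0.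
  have [w1|w1] := ltP (w 1 x) 0; first by left.
  right; split=> //.
    by exists z; rewrite /recolor (negbTE zy) (negbTE xy) andbF.
  move=> z'; have [xv|xv] := eqVneq x v; last by rewrite recolor_id.
  rewrite xv recolor_at //; case: ifP => _; last by rewrite -xv.
  have /negbTE s1 : s != 1 by apply: contraTneq w1 => /ws1; rewrite xv -ltNge.
  by case: (s) s12 s1 sp => [|[|[|]]] // _ _; case: (p) => [|[|[]]].
move=> S v m [c [w [pc sc rd]]] vS mS cm cons.
have [l [b [Em l0 um iso deg2]]] := ear_shape sc cm mS vS.
have /and3P[_ cycm _] := cm; have {}deg2 := deg2 _ _ pc.
have [s [s12 wsv s_deg lt_s ws1]] := ready_reserved pc (rd v).
have [|p0 [p0k]] := @free_color _ _ _ c w v [:: s] pc.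
  by rewrite /= /k; lia.
rewrite inE => p0s vp0.
have [|q0 [q0k]] := @free_color _ _ _ c w v [:: p0; s] pc; first by rewrite /= ltnS.
rewrite !inE negb_or => /andP[q0p0 q0s] vq0.
have sp0 : (s < p0)%N by apply: lt_s => //; case/andP: p0k.
have sq0 : (s < q0)%N by apply: lt_s => //; case/andP: q0k.
(* When [s = 1], the end [b] of positive weight has to miss colour 2, so colour
   2 must not be the one of the edge between [v] and [b]. *)
have [p [q [[p2 pq] [spk vp] [sqk vq]]]] : exists p q, [/\ p != 2 /\ p != q,
    (s < p <= k)%N /\ (forall y, c v y != p) & (s < q <= k)%N /\ (forall y, c v y != q)].
  have [E|p02] := eqVneq p0 2; [exists q0, p0 | exists p0, q0].
    by rewrite -{1}E; split; split=> //; lia.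
  by rewrite eq_sym in q0p0; split; split=> //; lia.
have [s0 sk] : (0 < s)%N /\ (s.+2 <= k)%N by rewrite /k; lia.
have s_eq1 : (s < 2)%N -> s = 1 by lia.
have s_gt1 : s != 1 -> (1 < s)%N by lia.
rewrite Em in cycm um iso.
set a := w s v in wsv.
(* Since [a < 0], the vertex [b] can be positive while its sum with [v] stays
   negative, and the other vertices of the cycle are all negative. *)
have [||||||c' [w' [ec new neg_old neg_l [bub bs bp wb]]]] :=
  @peeling_ear _ _ _ s c w v l b p q (- a / 2) (a / 4) a pc s0 sk cycm um l0 iso spk sqk pq vp vq.
1-6: by rewrite -/a; lra.
exists c', w'; split; first exact: ear_peel ec.
  by rewrite Em in mS cons *; apply: (spans_ear ec).
move=> x; have [xm|xm] := boolP (x \in rcons l b).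
  have [s1|s1] := eqVneq s 1; last by left; apply: neg_old; rewrite ?s_gt1.
  rewrite s1 in neg_l bs bp wb bub.
  move: xm; rewrite mem_rcons inE => /predU1P[->|xl]; last first.
    by left; case: (neg_l x xl) => ->; lra.
  right; split=> //.
    by move=> y; case/or3P: (bp y) => /eqP-> //.
  by apply: wb; rewrite // eq_sym.
rewrite /ready !(ear_wold ec _ xm).
have [w1|w1] := ltP (w 1 x) 0; first by left.
case: (rd x) => [|[[z xz] x2 w2]]; first by rewrite ltNge w1.
right; split=> //.
  exists z; rewrite (ear_old ec) //; apply: contra_eqN xz => zm.
  by rewrite (peel_sym pc) iso.
move=> y; have [ym|ym] := boolP (y \in rcons l b); last by rewrite (ear_old ec).
apply/negP => /eqP cxy.
have := ear_new ec ym (y := x); rewrite (peel_sym (ear_peel ec)) cxy => /(_ isT).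
rewrite inE (negbTE xm) orbF => /eqP xv; rewrite xv in cxy w1.
have := new y ym; rewrite cxy => /(_ isT)/s_eq1/ws1.
by rewrite ltNge w1.
Qed.

(** Every cycle gets exactly one edge of colour 1, and this edge can be placed
    whatever the weight of the root is, since no cycle is a triangle. *)
Lemma cactus_peeling_tight (r : G) :
  (forall c : seq G, is_cycle c -> (3 < size c)%N) ->
  (forall c : seq G, is_cycle c -> (2 < max_valency G)%N) ->
  exists c w, peeling (max_valency G) c w /\ spans c setT.
Proof.
move=> cyc4 cyc3; set k := max_valency G.
pose P S := exists c w, peeling k c w /\ spans c S.
apply: (cactus_ind (P := P) hG (r := r)).
- by exists (fun _ _ => 0), (fun _ _ => - 1); split; [apply: peeling0|apply: spans0].
- move=> S v y [c [w [pc sc]]] vS yS vy yv.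
  have y0 z : c y z = 0 by apply: sc.2.
  have deg : (colored_degree c v + 1 <= max_valency G)%N.
    rewrite -(cards1 y); apply: (colored_degree_le pc) => z; rewrite inE => /eqP->.
    by rewrite vy (peel_sym pc) y0.
  have [|p [pk _ vp]] := @free_color _ _ _ c w v [::] pc; first by rewrite addn0 -addn1.
  exists (recolor c v y p), (hang w v y p); split; first exact: peeling_hang.
  by apply: spans_pendant => //; case/andP: pk.
move=> S v m [c [w [pc sc]]] vS mS cm cons.
have [l [b [Em l0 um iso deg2]]] := ear_shape sc cm mS vS.
have /and3P[_ cycm _] := cm; have {}deg2 := deg2 _ _ pc.
have k3 : (3 <= k)%N by apply: cyc3 cm.
have l2 : (1 < size l)%N.
  by have := cyc4 _ cm; rewrite Em /= size_rcons.
have [|p [pk _ vp]] := @free_color _ _ _ c w v [::] pc; first by rewrite /k /=; lia.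
have [|q [qk]] := @free_color _ _ _ c w v [:: p] pc; first by rewrite /k /=; lia.
rewrite inE => qp vq; rewrite Em in cycm um iso mS cons *.
suff [c' [w' ec]] : exists c' w', ear_colored k c w v (rcons l b) c' w'.
  exists c', w'; split; first exact: ear_peel ec.
  by apply: (spans_ear ec).
have [p1|p1] := eqVneq p 1.
  rewrite p1 in qp vp.
  by apply: (peeling_ear_first (q := q) pc k3 cycm um l0 iso) => //; lia.
have [q1|q1] := eqVneq q 1.
  rewrite q1 in vq.
  by apply: (peeling_ear_first (q := p) pc k3 cycm um l0 iso) => //; lia.
have pk1 : (1 < p <= k)%N by lia.
have qk1 : (1 < q <= k)%N by lia.
rewrite eq_sym in qp.
have n1 := ler_norm (w 1 v); have n2 := normr_ge0 (w 1 v).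
(* [b] outweighs [v], [z] outweighs [b], and the rest outweighs [z]. *)
have [||||||c' [w' [ec _ _ _ _]]] := @peeling_ear _ _ _ 1 c w v l b p q (- (1 + `|w 1 v|))
  (2 + `|w 1 v|) (- (3 + `|w 1 v|)) pc isT k3 cycm um l0 iso pk1 qk1 qp vp vq.
1-5: by lra.
  by rewrite l2.
by exists c', w'.
Qed.

End CactusPeeling.

Theorem corollary2p5 (R : realType) (G : sgraph) (hG : cactus G) :
  (max_valency G <= pmd R G /\ pmd R G <= max_valency G + 1) /\
  (triangle_free G -> ~ is_cycle_graph G -> pmd R G = max_valency G).
Proof.
have finish k (c : G -> G -> nat) (w : nat -> G -> R) :
    peeling k c w -> spans c setT -> pmd R G <= k.
  move=> pc [cT _]; apply: (peeling_pmd pc) => x y; apply: cT; exact: in_setT.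
have low := valency_le_pmd R G.
case: (pickP G) => [r _|G0]; last first.
  have pmd0 : pmd R G <= 0.
    by apply: (finish 0 _ _ (peeling0 R G 0)); split=> x y; have := G0 x.
  split=> [|_ _]; first by rewrite (leq_trans pmd0).
  by apply/eqP; rewrite eqn_leq low (leq_trans pmd0).
split=> [|tf nocyc].
  have [c [w [pc cT]]] := cactus_peeling R hG r.
  by rewrite addn1 (finish _ _ _ pc cT).
have [||c [w [pc cT]]] := cactus_peeling_tight R hG r.
- by move=> c; apply: cycle_size_gt3.
- by move=> c; apply: noncycle_max_valency_gt2 => //; case: hG.
by apply/eqP; rewrite eqn_leq low (finish _ _ _ pc cT).
Qed.
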